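(* Assume the Continuum Hypothesis. There is an almost disjoint $(\aleph_0,\aleph_1)$-graph $G$ such that no minor of $G$ which is an $(\aleph_0,\aleph_1)$-graph is indivisible or of binary type.
   Context: An $(\aleph_0,\aleph_1)$-graph is a bipartite graph with bipartition $(A,B)$, $|A|=\aleph_0$, $|B|=\aleph_1$, every vertex of $B$ of infinite degree; it is almost disjoint if any two distinct vertices of $B$ have finitely many common neighbours. A graph $H$ is a minor of $G$ if to each vertex $x$ of $H$ one can assign a connected set $V_x\subseteq V(G)$, pairwise disjoint, such that $G$ has a $V_x$–$V_y$ edge whenever $xy\in E(H)$. An $(\aleph_0,\aleph_1)$-graph with bipartition $(A,B)$ is indivisible if for every partition $A=A_1\,\dot\cup\, A_2$, at most one of the induced subgraphs on $A_1\cup B$ and $A_2\cup B$ contains an $(\aleph_0,\aleph_1)$-graph as a subgraph. An $(\aleph_0,\aleph_1)$-graph is of binary type (a binary tree with tops) if it is isomorphic to a graph obtained as follows: take $A=2^{<\omega}$ (finite binary sequences ordered by extension), a set $B$ of $\aleph_1$ many distinct branches of $A$, and join each $b\in B$ to infinitely many nodes of its branch, with no other edges. *)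

(* Defs.v *)
From mathcomp Require Import all_boot.
From mathcomp Require Import boolp classical_sets functions cardinality.
From Stdlib Require Import Relation_Operators.

Set Implicit Arguments.
Unset Strict Implicit.
Unset Printing Implicit Defensive.

Local Open Scope classical_set_scope.
Local Open Scope card_scope.

(** * Cardinals *)

Definition aleph0_card (T : Type) (X : set T) : Prop := X #= [set: nat].

(* aleph_1 is the least uncountable cardinal. *)
Definition aleph1_card (T : Type) (X : set T) : Prop :=
  ~ countable X /\
  forall (U : Type) (Y : set U), ~ countable Y -> X #<= Y.

(* 2 ^ aleph_0 = aleph_1 *)
Definition continuum_hypothesis : Prop := aleph1_card [set: set nat].

(** * Graphs *)

(* Simple graphs whose vertex set is a subset of an ambient type, so that
   subgraphs live on the same type. *)
Record graph (V : Type) := Graph {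
  verts : set V;
  adj : V -> V -> Prop;
  adj_sym : forall x y, adj x y -> adj y x;
  adj_irrefl : forall x, ~ adj x x;
  adj_verts : forall x y, adj x y -> verts x
}.

Definition neighbours (V : Type) (G : graph V) (x : V) : set V :=
  [set y | adj G x y].

Definition subgraph (V : Type) (H G : graph V) : Prop :=
  verts H `<=` verts G /\ forall x y, adj H x y -> adj G x y.

Section Induced.
Variables (V : Type) (G : graph V) (S : set V).

Definition induced_adj (x y : V) : Prop := [/\ S x, S y & adj G x y].

Lemma induced_sym x y : induced_adj x y -> induced_adj y x.
Proof. by case=> Sx Sy Gxy; split=> //; apply: adj_sym. Qed.

Lemma induced_irrefl x : ~ induced_adj x x.
Proof. by case=> _ _; apply: adj_irrefl. Qed.

Lemma induced_verts x y : induced_adj x y -> (verts G `&` S) x.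
Proof. by case=> Sx _ Gxy; split=> //; apply: adj_verts Gxy. Qed.

Definition induced : graph V :=
  Graph induced_sym induced_irrefl induced_verts.
End Induced.

Definition isomorphic (V W : Type) (G : graph V) (H : graph W) : Prop :=
  exists f : V -> W, set_bij (verts G) (verts H) f /\
    forall x y, verts G x -> verts G y -> (adj G x y <-> adj H (f x) (f y)).

(* Connected sets are nonempty; [induced_adj G S] restricts paths to S. *)
Definition connected_set (V : Type) (G : graph V) (S : set V) : Prop :=
  [/\ S `<=` verts G, S !=set0 &
      forall x y, S x -> S y -> clos_refl_trans V (induced_adj G S) x y].

Definition minor (W V : Type) (H : graph W) (G : graph V) : Prop :=
  exists branch_set : W -> set V,
  [/\ forall x, verts H x -> connected_set G (branch_set x),
      trivIset (verts H) branch_set &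
      forall x y, adj H x y ->
        exists u v, [/\ branch_set x u, branch_set y v & adj G u v]].

Definition bipartition (V : Type) (G : graph V) (A B : set V) : Prop :=
  [/\ verts G = A `|` B, A `&` B = set0 &
      forall x y, adj G x y -> (A x /\ B y) \/ (B x /\ A y)].

(** * (aleph_0, aleph_1)-graphs *)

Definition aleph01_graph (V : Type) (G : graph V) (A B : set V) : Prop :=
  [/\ bipartition G A B, aleph0_card A, aleph1_card B &
      forall b, B b -> infinite_set (neighbours G b)].

Definition almost_disjoint (V : Type) (G : graph V) (B : set V) : Prop :=
  forall b c, B b -> B c -> b <> c ->
    finite_set (neighbours G b `&` neighbours G c).

Definition contains_aleph01_graph (V : Type) (G : graph V) : Prop :=
  exists (H : graph V) (A B : set V), subgraph H G /\ aleph01_graph H A B.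

Definition indivisible (V : Type) (G : graph V) (A B : set V) : Prop :=
  forall A1 A2 : set V, A = A1 `|` A2 -> A1 `&` A2 = set0 ->
    ~ (contains_aleph01_graph (induced G (A1 `|` B)) /\
       contains_aleph01_graph (induced G (A2 `|` B))).

(** * Binary trees with tops *)

Definition tree_chain (C : set (seq bool)) : Prop :=
  total_on C (fun s t => prefix s t).

(* A branch of 2^{<omega} is a maximal chain. *)
Definition tree_branch (C : set (seq bool)) : Prop :=
  tree_chain C /\ forall D, tree_chain D -> C `<=` D -> D = C.

(* [inl s] is the node s, [inr b] is the top of the branch b. *)
Definition binary_tree_with_tops
    (T : graph (seq bool + set (seq bool))) : Prop :=
  exists B : set (set (seq bool)),
  [/\ B `<=` tree_branch, aleph1_card B,
      verts T = inl @` [set: seq bool] `|` inr @` B,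
      forall s t, ~ adj T (inl s) (inl t) &
      forall b, B b -> neighbours T (inr b) `<=` inl @` b /\
                       infinite_set (neighbours T (inr b))].

Definition binary_type (V : Type) (G : graph V) : Prop :=
  exists T, binary_tree_with_tops T /\ isomorphic G T.

(* Main.v *)
Require Import Defs.
From mathcomp Require Import all_boot.
From mathcomp Require Import boolp classical_sets functions cardinality.
From mathcomp Require Import wochoice.
From Stdlib Require Import Relation_Operators.

(** The host graph has countable side A = 2^{<omega}, and its tops are infinite
    sets b_r of nodes converging to distinct points x_r of 2^omega, so that it is
    almost disjoint.  In a minor all but countably many vertices of the large side
    come from single tops, so the minor is described, up to countably many tops,
    by a partial map f : A -> 2^{<omega} sending a node to (a code of) the vertex
    of the small side whose branch set contains it.  Under CH these maps can be
    treated in order type omega_1.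

    By recursion one builds dense sets A_r of nodes, decreasing modulo finite sets,
    such that below densely many nodes t the map f is, on A_r, either constant, or
    injective and then either with values in one chain or such that every chain has
    a nowhere dense preimage.  The set b_r is almost contained in all earlier A_q and
    x_r is generic for the dense sets of nodes t; a Koenig argument makes the image
    of b_r under f meet every chain in a finite set in the last case.  Now constant f
    is impossible for a minor.  If f is injective below t, the convergence of the tops
    to distinct points is transported to the minor, and splitting 2^omega at a node
    with uncountably many x_r on either side divides it.  Were the minor of binary
    type, the tops would run along distinct branches, all of which have infinite
    intersection with one chain, or which meet the image of b_r in a finite set. *)

Set Implicit Arguments.
Unset Strict Implicit.
Unset Printing Implicit Defensive.

Local Open Scope classical_set_scope.
Local Open Scope card_scope.

(** * Countability, well-orders and recursion *)

Lemma countable_inj (T U : Type) (A : set T) (B : set U) (f : T -> U) :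
  countable B -> (forall x, A x -> B (f x)) ->
  (forall x y, A x -> A y -> f x = f y -> x = y) -> countable A.
Proof.
move=> /countable_injP[g ginj] fB finj; apply/countable_injP.
exists (g \o f) => x y /set_mem Ax /set_mem Ay /= e; apply: finj => //.
by apply: ginj e; rewrite inE; apply: fB.
Qed.

Lemma card_le_inj (T U : Type) (A : set T) (B : set U) (f : T -> U) :
  (forall x, A x -> B (f x)) ->
  (forall x y, A x -> A y -> f x = f y -> x = y) -> A #<= B.
Proof.
move=> fB finj.
have imB : f @` A `<=` B by move=> _ [x Ax <-]; apply: fB.
apply: card_le_trans (subset_card_le imB).
have : f @` A #= A.
  by apply: inj_card_eq => x y /set_mem Ax /set_mem Ay; apply: finj.
by rewrite card_eq_le => /andP[].
Qed.

Lemma inj_of_card_le (T U : Type) (A : set U) : [set: T] #<= A ->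
  exists f : T -> U, (forall x, A (f x)) /\ injective f.
Proof.
move=> /card_leP[f]; exists (fun x => set_val (f (to_setT x))).
split=> [x|x y /val_inj e]; first exact/set_mem/valP.
suff : to_setT x = to_setT y by move/(congr1 set_val).
by apply: (@inj _ _ _ f) => //; rewrite inE.
Qed.

Lemma uncountable_bigcup (T : Type) (S : set T) (F : nat -> set T) :
  ~ countable S -> (forall x, S x -> exists n, F n x) ->
  exists n, ~ countable (S `&` F n).
Proof.
move=> uS cov; apply: contrapT => /forallNP cF; apply: uS.
have -> : S = \bigcup_(n in [set: nat]) (S `&` F n).
  apply/seteqP; split=> [x Sx|x [n _ [] //]].
  by have [n Fx] := cov x Sx; exists n.
by apply: bigcup_countable => // n _; apply: contrapT.
Qed.

Lemma uncountable_setD (T : Type) (A B : set T) :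
  ~ countable A -> countable B -> ~ countable (A `\` B).
Proof.
move=> uA cB cAB; have [] // := @uncountable_bigcup _ A
  (fun n => if n is 0 then B else A `\` B) uA _.
  by move=> x Ax; have [Bx|nBx] := pselect (B x); [exists 0|exists 1].
case=> [|n] []; last by apply: sub_countable cAB; apply: subset_card_le => x [].
by apply: sub_countable cB; apply: subset_card_le => x [].
Qed.

Lemma uncountable_ex (T : Type) (S : set T) : ~ countable S -> exists x, S x.
Proof.
move=> uS; apply: contrapT => noS; apply: uS.
by rewrite (_ : S = set0) //; apply/seteqP; split=> // x Sx; apply: noS; exists x.
Qed.

Lemma finite_cover (T : Type) (A B C : set T) :
  finite_set A -> finite_set B -> C `<=` A `|` B -> finite_set C.
Proof. by move=> fA fB CAB; apply: sub_finite_set CAB _; rewrite finite_setU. Qed.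

Lemma finite_setDI (T : Type) (X A B : set T) :
  finite_set (X `\` A) -> finite_set (X `\` B) -> finite_set (X `\` (A `&` B)).
Proof. by move=> fA fB; apply: finite_cover fA fB _; rewrite setDIr. Qed.

Lemma finite_setDT (T : Type) (X : set T) : finite_set (X `\` setT).
Proof. by rewrite setDT. Qed.

Lemma wf_min (T : Type) (lt : T -> T -> Prop) (P : T -> Prop) :
  well_founded lt -> (exists x, P x) ->
  exists x, P x /\ forall y, lt y x -> ~ P y.
Proof.
move=> wf [x0 Px0]; apply: contrapT => /forallNP no.
have: forall x, ~ P x; last by move/(_ x0).
by move=> x; elim: (wf x) => {}x _ IH Px; apply: (no x).
Qed.

(** Countable initial segments let each stage of a recursion along [lt] list the earlier stages in a
    sequence indexed by [nat]. *)
Definition omega1_order (T : Type) (lt : T -> T -> Prop) : Prop :=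
  [/\ well_founded lt, (forall x y z, lt x y -> lt y z -> lt x z),
      (forall x y, [\/ lt x y, x = y | lt y x]) &
      forall x, countable [set y | lt y x]].

(** Uniqueness of least elements of pairs gives antisymmetry; least elements of triples then give
    transitivity. *)
Lemma well_order_type (T : Type) : exists lt : T -> T -> Prop,
  [/\ well_founded lt, (forall x y z, lt x y -> lt y z -> lt x z) &
      (forall x y, [\/ lt x y, x = y | lt y x])].
Proof.
have [R Rwo] := well_ordering_principle {classic T}.
have Rmin (P : T -> Prop) : (exists x, P x) ->
    exists2 z : {classic T}, P z & forall y : {classic T}, P y -> R z y.
  move=> [x Px]; have [|z [[zP zlb] _]] := Rwo [pred y : {classic T} | `[< P y >]].
    by exists x; rewrite inE.
  exists z; first by move: zP; rewrite inE.
  by move=> y Py; apply: zlb; rewrite inE.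
have tot (x y : {classic T}) : R x y \/ R y x.
  have [|z zxy zlb] := Rmin (fun z => z = x \/ z = y); first by exists x; left.
  by case: zxy zlb => -> zlb; [left; apply: zlb; right|right; apply: zlb; left].
have anti (x y : {classic T}) : R x y -> R y x -> x = y.
  have [|z [_ uz]] := Rwo [pred z : {classic T} | (z == x) || (z == y)].
    by exists x; rewrite inE eqxx.
  have refl w : R w w by case: (tot w w).
  move=> xy yx; transitivity z.
    apply/esym/uz; split; first by rewrite inE eqxx.
    by move=> w; rewrite inE => /orP[] /eqP->.
  apply: uz; split; first by rewrite inE eqxx orbT.
  by move=> w; rewrite inE => /orP[] /eqP->.
exists (fun x y : {classic T} => R x y /\ x <> y); split.
- move=> x; apply: contrapT => nAx.
  have [|z nAz zlb] := Rmin (fun z => ~ Acc (fun x y : {classic T} => R x y /\ x <> y) z).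
    by exists x.
  apply: nAz; constructor => y [yz ynz]; apply: contrapT => nAy.
  by apply: ynz; apply: anti => //; apply: zlb.
- move=> x y z [xy nxy] [yz nyz].
  have [|w wxyz wlb] := Rmin (fun w => [\/ w = x, w = y | w = z]).
    by exists x; constructor 1.
  have wx := wlb x (Or31 _ _ erefl); have wy := wlb y (Or32 _ _ erefl).
  have wz := wlb z (Or33 _ _ erefl).
  case: wxyz => e; rewrite e in wx wy wz.
  + by split=> // exz; apply: nxy; apply: anti => //; rewrite exz.
  + by case: nxy; apply: anti.
  + by case: nyz; apply: anti.
- move=> x y; have [->|nxy] := pselect (x = y); first by constructor 2.
  case: (tot x y) => xy; [by constructor 1|constructor 3; split=> // e].
  exact: nxy.
Qed.

(** If some initial segment of a well-order is uncountable, take the least [m] that bounds one: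
    minimality of aleph_1 embeds [T] below [m], and the order pulled back along the embedding has
    countable segments. *)
Lemma aleph1_order (T : Type) : aleph1_card [set: T] ->
  exists lt : T -> T -> Prop, omega1_order lt.
Proof.
move=> [_ leT]; have [lt [wf tr tot]] := well_order_type T.
have [cseg|/existsNP ex] := pselect (forall x, countable [set y | lt y x]).
  by exists lt.
have [m [um minm]] := wf_min wf ex.
have [i [im iinj]] := inj_of_card_le (leT _ _ um).
exists (fun x y => lt (i x) (i y)); split.
- move=> x; have [z zix] : exists z, z = i x by exists (i x).
  elim: (wf z) x zix => {}z _ IH x zix; constructor => y.
  by rewrite -zix => /IH; apply.
- by move=> x y z; apply: tr.
- move=> x y; case: (tot (i x) (i y)) => [?|/iinj ->|?].
  + by constructor 1.
  + by constructor 2.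
  + by constructor 3.
- move=> x; have /contrapT c := minm _ (im x).
  by apply: (@countable_inj _ _ _ _ i c) => // y z _ _ /iinj.
Qed.

(** Transfinite recursion with choices: [Phi x g] may look at [g] only below [x], and a value has to
    exist only when the earlier values were chosen correctly. *)
Lemma wf_choice (I T : Type) (lt : I -> I -> Prop) (Phi : I -> (I -> T) -> T -> Prop) :
  well_founded lt -> (exists v : T, True) ->
  (forall x g g' v, (forall y, lt y x -> g y = g' y) -> Phi x g v -> Phi x g' v) ->
  (forall x g, (forall y, lt y x -> Phi y g (g y)) -> exists v, Phi x g v) ->
  exists g, forall x, Phi x g (g x).
Proof.
move=> wf [v0 _] loc step.
(* The partial history is completed by the default [v0]; by [loc] this does not affect [Phi x]. *)
pose ext x (h : forall y, lt y x -> T) y :=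
  if pselect (lt y x) is left yx then h y yx else v0.
pose F x (h : forall y, lt y x -> T) : T := xget (v0 : {classic T}) [set v | Phi x (ext x h) v].
pose g := Fix wf (fun=> T) F.
have gE x : g x = F x (fun y _ => g y).
  apply: Fix_eq => {}x h h' hh'; congr F.
  by apply: functional_extensionality_dep => y; apply: functional_extensionality_dep.
exists g => x; elim: (wf x) => {}x _ IH; rewrite gE.
have eqg y : lt y x -> g y = ext x (fun y _ => g y) y.
  by move=> yx; rewrite /ext; case: pselect.
apply: (loc x (ext x (fun y _ => g y))) => [y /eqg //|].
apply: (@xgetPex {classic T} v0 [set v | Phi x _ v]).
have [v Pv] := step x g IH.
by exists v; apply: loc Pv.
Qed.

Lemma history_choice (T : Type) (P : nat -> seq T -> T -> Prop) :
  (forall n l, exists a, P n l a) ->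
  exists u : nat -> T, forall n, P n (mkseq u n) (u n).
Proof.
move=> ex; have [h hP] := choice (fun nl : nat * seq T => ex nl.1 nl.2).
pose L := fix L n := if n is m.+1 then rcons (L m) (h (m, L m)) else [::].
exists (fun n => h (n, L n)) => n.
suff <- : L n = mkseq (fun n => h (n, L n)) n by apply: (hP (n, L n)).
by elim: n => // n IH; rewrite mkseqS -IH.
Qed.

(** * Dense sets of nodes *)

Notation node := (seq bool).

Implicit Types (s t a : node) (X Y : set node) (f : node -> option node).

Definition cone s : set node := [set a | prefix s a].

(** The node [t] lies on the branch given by the point [x] of 2^omega. *)
Definition branch_upto (x : nat -> bool) (t : node) : Prop := t = mkseq x (size t).

Lemma prefix_comparable s t a :
  prefix s a -> prefix t a -> size s <= size t -> prefix s t.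
Proof.
rewrite !prefixE => /eqP sa /eqP ta st.
by rewrite -ta take_takel // sa.
Qed.

Lemma prefix_mkseq (x : nat -> bool) m n : m <= n -> prefix (mkseq x m) (mkseq x n).
Proof. by move=> mn; rewrite prefixE size_mkseq /mkseq -map_take take_iota (minn_idPl mn). Qed.

Lemma mkseq_prefix (x : nat -> bool) t n : prefix t (mkseq x n) -> branch_upto x t.
Proof.
move=> tn; have := size_prefix tn; rewrite size_mkseq => le.
move: tn; rewrite prefixE /mkseq -map_take take_iota (minn_idPl le) => /eqP e.
by rewrite /branch_upto -{1}e.
Qed.

Lemma limit_branch (T : nat -> node) :
  (forall n, prefix (T n) (T n.+1)) -> (forall n, n <= size (T n)) ->
  exists x, forall n, branch_upto x (T n).
Proof.
(* [T m.+1] has length at least [m.+1], so its entry at position [m] is not the default. *)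
move=> pT sT; pose x m := nth false (T m.+1) m; exists x => n.
have mono m k : m <= k -> prefix (T m) (T k).
  elim: k => [|k IH]; first by rewrite leqn0 => /eqP ->; apply: prefix_refl.
  rewrite leq_eqVlt => /orP[/eqP ->|]; first exact: prefix_refl.
  by rewrite ltnS => /IH /prefix_trans; apply.
have nthT m k i : m <= k -> i < size (T m) -> nth false (T k) i = nth false (T m) i.
  by move=> /mono /prefixP[w ->] im; rewrite nth_cat im.
rewrite /branch_upto; apply: (@eq_from_nth _ false); first by rewrite size_mkseq.
move=> i iT; rewrite nth_mkseq // /x.
have [le|/ltnW le] := leqP i.+1 n; first exact: nthT.
by rewrite -(nthT n i.+1).
Qed.

Definition dense_in X s : Prop := forall t, prefix s t -> exists2 a, X a & prefix t a.

Definition dense X : Prop := dense_in X [::].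

Definition nowhere_dense X : Prop := forall s, ~ dense_in X s.

Lemma dense_inW X s t : prefix s t -> dense_in X s -> dense_in X t.
Proof. by move=> st dX u tu; apply: dX; apply: prefix_trans tu. Qed.

Lemma denseW X s : dense X -> dense_in X s.
Proof. by apply: dense_inW; apply: prefix0s. Qed.

Lemma dense_in_sub X Y s : X `<=` Y -> dense_in X s -> dense_in Y s.
Proof. by move=> XY dX t /dX[a /XY Ya ta]; exists a. Qed.

Lemma dense_in_cone X s : dense_in X s -> dense_in (X `&` cone s) s.
Proof.
move=> dX t st; have [a Xa ta] := dX t st.
by exists a => //; split=> //; apply: prefix_trans ta.
Qed.

Lemma not_dense_in X s : ~ dense_in X s ->
  exists2 t, prefix s t & forall a, X a -> ~ prefix t a.
Proof.
move=> /existsNP[t /not_implyP[st /forall2NP no]]; exists t => // a Xa ta.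
by case: (no a).
Qed.

Lemma nowhere_dense_sub X Y : X `<=` Y -> nowhere_dense Y -> nowhere_dense X.
Proof. by move=> XY nY s /(dense_in_sub XY)/nY. Qed.

(** Pass to a cone that misses [X], where [Y] alone would have to be dense. Nowhere dense sets thus
    form an ideal; its complement provides the large sets of the Koenig argument. *)
Lemma nowhere_denseU X Y :
  nowhere_dense X -> nowhere_dense Y -> nowhere_dense (X `|` Y).
Proof.
move=> nX nY s dXY; have [t st noX] := not_dense_in (nX s).
apply: (nY t) => u tu; have [a [Xa|Ya] ua] := dXY u (prefix_trans st tu).
  by case: (noX _ Xa); apply: prefix_trans ua.
by exists a.
Qed.

Lemma finite_size_bound X : finite_set X -> exists n, forall a, X a -> size a <= n.
Proof.
move=> /finite_seqP[l ->]; exists (\max_(a <- l) size a) => a /= al.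
exact: leq_bigmax_seq.
Qed.

Lemma dense_in_setD X Y s : finite_set Y -> dense_in X s -> dense_in (X `\` Y) s.
Proof.
move=> /finite_size_bound[n Yn] dX t st.
have tt : prefix t (t ++ nseq n.+1 true) by apply: prefix_prefix.
have [a Xa ta] := dX _ (prefix_trans st tt).
exists a; last exact: prefix_trans ta.
split=> // /Yn; rewrite leqNgt => /negP; apply.
by apply: leq_trans (size_prefix ta); rewrite size_cat size_nseq addnC leq_addr.
Qed.

Lemma finite_nowhere_dense X : finite_set X -> nowhere_dense X.
Proof.
move=> fX s /(dense_in_setD fX)/(_ s (prefix_refl s))[a [Xa nXa] _]; exact: nXa.
Qed.

(** * Pseudo-intersections and generic points *)

Definition nth_node (n : nat) : node := odflt [::] (unpickle n).

Lemma nth_nodeK s : nth_node (pickle s) = s.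
Proof. by rewrite /nth_node pickleK. Qed.

(** The [n]-th point is chosen above the [n]-th node and in [X 0], ..., [X n]; hence only the first
    [i] points can miss [X i]. *)
Lemma pseudo_intersection (X : nat -> set node) :
  (forall n, dense [set a | forall i, i < n -> X i a]) ->
  exists2 Y, dense Y & forall i, finite_set (Y `\` X i).
Proof.
move=> dX.
have [|u uP] := @choice nat node (fun n a =>
    prefix (nth_node n) a /\ forall i, i <= n -> X i a).
  move=> n.
  have [a Xa na] := dX n.+1 (nth_node n) (prefix0s _).
  by exists a; split.
exists (range u).
  move=> t _; exists (u (pickle t)); first by exists (pickle t).
  by have [+ _] := uP (pickle t); rewrite nth_nodeK.
move=> i; apply: sub_finite_set (finite_image u (finite_II i)).
move=> _ [[n _ <-] nX]; exists n => //=.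
by rewrite ltnNge; apply/negP => /(uP n).2.
Qed.

(** Among finitely many sets that form a chain modulo finite sets, one is almost contained in all
    the others. *)
Lemma dense_chain (X : nat -> set node) : (forall i, dense (X i)) ->
  (forall i j, finite_set (X i `\` X j) \/ finite_set (X j `\` X i)) ->
  forall n, dense [set a | forall i, i < n -> X i a].
Proof.
move=> dX ch n.
have [j fj] : exists j, finite_set (X j `\` [set a | forall i, i < n -> X i a]).
  elim: n => [|n [j fj]].
    by exists 0; apply: sub_finite_set (finite_setDT (X 0)) => a [Xa []].
  have sub a : X n a -> (forall i, i < n -> X i a) -> forall i, i < n.+1 -> X i a.
    by move=> Xn Xa i; rewrite ltnS leq_eqVlt => /orP[/eqP ->|/Xa].
  have [fjn|fnj] := ch j n; [exists j|exists n].
    by apply: sub_finite_set (finite_setDI fjn fj) => a [Xa na]; split=> // -[/sub h /h].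
  apply: finite_cover fnj fj _ => a [Xa na].
  by have [Xja|] := pselect (X j a); [right; split=> // /(sub a Xa)|left].
by apply: dense_in_sub (dense_in_setD fj (dX j)) => a [Xa] nn; apply: contrapT => h; apply: nn.
Qed.

(** The Rasiowa-Sikorski construction: extend a node into one [E n] after another. An [E n] that is
    not dense imposes nothing. *)
Lemma generic_branch (E : nat -> node -> Prop) : exists x, forall n,
  (forall s, exists2 t, prefix s t & E n t) -> exists2 t, E n t & branch_upto x t.
Proof.
have [|h hP] := @choice (nat * node) node (fun ns t => [/\ prefix ns.2 t,
    size ns.2 < size t & (forall s, exists2 t, prefix s t & E ns.1 t) -> E ns.1 t]).
  case=> n s /=; have [dE|nE] := pselect (forall s, exists2 t, prefix s t & E n t).
    (* Density is applied to a proper extension of [s], so that the nodes grow and have an infinite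
       limit. *)
    have [t st Et] := dE (rcons s true); exists t; split=> //.
      by apply: prefix_trans st; apply: prefix_rcons.
    by have := size_prefix st; rewrite size_rcons.
  by exists (rcons s true); split=> //; [apply: prefix_rcons|rewrite size_rcons].
pose T := fix T n := if n is m.+1 then h (m, T m) else [::].
have TP n := hP (n, T n).
have [x xT] : exists x, forall n, branch_upto x (T n).
  apply: limit_branch => n; first by have [] := TP n.
  by elim: n => // n IH; have [_ /= ltT _] := TP n; apply: leq_ltn_trans IH ltT.
by exists x => n dE; exists (T n.+1); [have [_ _ /(_ dE)] := TP n|].
Qed.

(** * Shrinking a dense set until a map is tame *)

Definition fpreimage f (C : set node) : set node := [set a | exists2 u, f a = Some u & C u].

Definition thin_on f Y : Prop :=
  forall C, tree_chain C -> nowhere_dense (Y `&` fpreimage f C).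

(** The constant in the first alternative may be [None]; the second demands values other than
    [None]. *)
Definition tame f Y : Prop :=
  (exists v, forall a, Y a -> f a = v) \/
  [/\ forall a, Y a -> f a <> None,
      forall a b, Y a -> Y b -> f a = f b -> a = b &
      (exists2 C, tree_chain C & Y `<=` fpreimage f C) \/ thin_on f Y].

Lemma tame_sub f X Y : X `<=` Y -> tame f Y -> tame f X.
Proof.
move=> XY [[v vY]|[Ysome Yinj YC]]; first by left; exists v => a /XY/vY.
right; split.
- by move=> a /XY/Ysome.
- by move=> a b /XY Ya /XY Yb; apply: Yinj.
- case: YC => [[C chC YC]|thin]; first by left; exists C => // a /XY/YC.
  by right => C /thin; apply: nowhere_dense_sub => a [/XY].
Qed.

(** As no fibre is dense in a cone above [s], finitely many values can be avoided by passing to a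
    smaller cone. Meeting the nodes above [s] one by one, always with a fresh value, gives [Y]. *)
Lemma injective_dense_subset f X s :
  dense_in X s ->
  (forall v t, prefix s t -> ~ dense_in (X `&` [set a | f a = v]) t) ->
  exists Y, [/\ Y `<=` X `&` cone s, dense_in Y s, forall a, Y a -> f a <> None &
                forall a b, Y a -> Y b -> f a = f b -> a = b].
Proof.
move=> dX noX.
have avoid (vs : seq (option node)) t : prefix s t ->
    exists2 a, X a /\ prefix t a & f a \notin vs.
  move=> st; suff [t' tt' no] : exists2 t', prefix t t' &
      forall a, X a -> prefix t' a -> f a \notin vs.
    have [a Xa ta] := dX _ (prefix_trans st tt'); exists a; last exact: no.
    by split=> //; apply: prefix_trans ta.
  elim: vs => [|v vs [t1 tt1 no1]]; first by exists t => //; apply: prefix_refl.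
  have [t2 t12 no2] := not_dense_in (noX v t1 (prefix_trans st tt1)).
  exists t2; first exact: prefix_trans t12.
  move=> a Xa ta; rewrite inE negb_or no1 ?andbT //; last exact: prefix_trans ta.
  by apply/eqP => fa; apply: (no2 a).
have [n l|u uP] := @history_choice node (fun n l a => prefix s (nth_node n) ->
    [/\ X a, prefix (nth_node n) a, f a <> None & forall b, b \in l -> f a <> f b]).
  have [st|nst] := boolP (prefix s (nth_node n)); last by exists [::].
  have [a [Xa na] /= fa] := avoid (None :: map f l) _ st.
  exists a => _; split=> //.
    by move=> fN; rewrite fN mem_head in fa.
  by move=> b bl fab; rewrite fab inE map_f ?orbT in fa.
exists [set u n | n in [set n | prefix s (nth_node n)]]; split.
- move=> _ [n /= sn <-]; have [Xu nu _ _] := uP n sn; split=> //.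
  exact: prefix_trans nu.
- move=> t st; have := uP (pickle t); rewrite nth_nodeK => /(_ st)[_ tu _ _].
  by exists (u (pickle t)) => //; exists (pickle t) => //=; rewrite nth_nodeK.
- by move=> _ [n /= sn <-]; have [] := uP n sn.
- have lt n m : prefix s (nth_node m) -> n < m -> f (u m) <> f (u n).
    by move=> sm nm; have [_ _ _ ] := uP m sm; apply; apply/mapP; exists n; rewrite ?mem_iota.
  move=> _ _ [n /= sn <-] [m /= sm <-] e; case: (ltngtP n m) => [nm|mn|-> //].
    by case: (lt _ _ sm nm).
  by case: (lt _ _ sn mn).
Qed.

(** Either some fibre of [f] is dense in a cone, or [f] can be made injective; then either the
    preimage of some chain is dense in a cone, or [f] is thin. *)
Lemma shrink_in f X s : dense_in X s ->
  exists Y t, [/\ Y `<=` X, prefix s t, dense_in Y t & tame f (Y `&` cone t)].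
Proof.
move=> dX.
have [[v [t [st dv]]]|nov] := pselect (exists v t,
    prefix s t /\ dense_in (X `&` [set a | f a = v]) t).
  exists (X `&` [set a | f a = v]), t; split=> //.
  by left; exists v => a [[]].
have [v t st dv|Y [YX dY Ysome Yinj]] := @injective_dense_subset f X s dX.
  by apply: nov; exists v, t.
have [[C [t [chC st dC]]]|noC] := pselect (exists C t,
    [/\ tree_chain C, prefix s t & dense_in (Y `&` fpreimage f C) t]).
  exists (Y `&` fpreimage f C), t; split=> //; first by move=> a [/YX[]].
  right; split; first by move=> a [[/Ysome]].
    by move=> a b [[Ya _] _] [[Yb _] _]; apply: Yinj.
  by left; exists C => // a [[]].
exists Y, s; split=> //; [by move=> a /YX[]|exact: prefix_refl|].
right; split; first by move=> a [/Ysome].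
  by move=> a b [Ya _] [Yb _]; apply: Yinj.
(* The node [u] need not lie above [s], but a point [a] of [Y] above [u] does, and density passes
   from [u] to [a]. *)
right=> C chC u du; have [a [[Ya sa] _] ua] := du u (prefix_refl u).
apply: noC; exists C, a; split=> //.
by apply: dense_in_sub (dense_inW ua du) => b [[]].
Qed.

(** Only the part of [X] inside the cone of [t] is replaced, which keeps density everywhere. *)
Lemma shrink f X s : dense X ->
  exists Y t, [/\ Y `<=` X, dense Y, prefix s t & tame f (Y `&` cone t)].
Proof.
move=> dX; have [Y [t [YX st dY tY]]] := shrink_in f (denseW (s := s) dX).
exists ((X `\` cone t) `|` (Y `&` cone t)), t; split=> //.
- by move=> a [[]|[/YX]].
- move=> u _.
  have [tu|ntu] := boolP (prefix t u).
    have [a Ya ua] := dY u tu; exists a => //; right; split=> //.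
    exact: prefix_trans ua.
  have [ut|nut] := boolP (prefix u t).
    have [a Ya ta] := dY t (prefix_refl t); exists a; first by right.
    exact: prefix_trans ta.
  have [a Xa ua] := dX u (prefix0s u); exists a => //; left; split=> // ta.
  case: (leqP (size t) (size u)) => [le|/ltnW le].
    by rewrite (prefix_comparable ta ua le) in ntu.
  by rewrite (prefix_comparable ua ta le) in nut.
- by apply: tame_sub tY => a [[[_ nta]|[]]].
Qed.

(** * Construction of a single top *)

(** Call [t] large if, in every [A n], the nodes mapped above [t] are not nowhere dense. By thinness
    the fibre of [t] is negligible, so a large node has a large child; this yields a branch [z] of
    large nodes. The values on [z] itself are negligible too, since [z] is a chain. *)
Lemma konig_thin f (A : nat -> set node) :
  (forall n m, n <= m -> A m `<=` A n) -> (forall n, ~ nowhere_dense (A n)) ->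
  (exists n0, (forall a, A n0 a -> f a <> None) /\ thin_on f (A n0)) ->
  exists A' : nat -> set node, [/\ forall n m, n <= m -> A' m `<=` A' n,
    forall n, ~ nowhere_dense (A' n), forall n, A' n `<=` A n &
    forall u : nat -> node, (forall n, exists K, forall k, K <= k -> A' n (u k)) ->
    forall C, tree_chain C -> exists K, forall k, K <= k -> ~ fpreimage f C (u k)].
Proof.
move=> decA posA [n0 [someA thinA]].
pose Q t := forall n, ~ nowhere_dense (A n `&` fpreimage f (cone t)).
have Q0 : Q [::].
  move=> n nd; apply: (posA (maxn n n0)); apply: nowhere_dense_sub nd => a Aa.
  split; first exact: (decA _ _ (leq_maxl n n0)).
  have := someA a (decA _ _ (leq_maxr _ _) _ Aa).
  by case fa: (f a) => [w|//] _; exists w => //; apply: prefix0s.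
have QS t : Q t -> exists b, Q (rcons t b).
  move=> Qt; apply: contrapT => /forallNP no.
  have /existsNP[n1 /contrapT nd1] := no true.
  have /existsNP[n2 /contrapT nd2] := no false.
  apply: (Qt (maxn n0 (maxn n1 n2))).
  have nd0 : nowhere_dense (A n0 `&` fpreimage f [set t]).
    by apply: thinA => v w /= -> ->; left; apply: prefix_refl.
  apply: nowhere_dense_sub (nowhere_denseU nd0 (nowhere_denseU nd1 nd2)) => a [Aa [w fa tw]].
  move/prefixP: tw fa => [[|[] w'] ->] fa.
  - left; split; first by apply: (decA _ _ _ _ Aa); apply: leq_maxl.
    by exists t => //; rewrite fa cats0.
  - right; left; split; first by apply: (decA _ _ _ _ Aa); rewrite 2!leq_max leqnn orbT.
    by exists (t ++ true :: w') => //; rewrite /cone/= -cat_rcons prefix_prefix.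
  - right; right; split; first by apply: (decA _ _ _ _ Aa); rewrite !leq_max leqnn !orbT.
    by exists (t ++ false :: w') => //; rewrite /cone/= -cat_rcons prefix_prefix.
have [|h hP] := @choice node bool (fun t b => Q t -> Q (rcons t b)).
  by move=> t; have [/QS[b Qb]|nQ] := pselect (Q t); [exists b|exists true].
pose T := fix T n := if n is m.+1 then rcons (T m) (h (T m)) else [::].
have sT n : size (T n) = n by elim: n => //= n IH; rewrite size_rcons IH.
have QT n : Q (T n) by elim: n => //= n /hP.
have [z zT] : exists z, forall n, branch_upto z (T n).
  by apply: limit_branch => n; [apply: prefix_rcons|rewrite sT].
have {QT zT} Qz n : Q (mkseq z n) by rewrite -{1}(sT n) -zT.
(* Nodes that branch off from z converge to z along any sequence eventually in all
   [A' n], so a chain can contain only finitely many of them. *)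
pose W n := [set w | prefix (mkseq z n) w /\ ~ branch_upto z w].
exists (fun n => A (maxn n n0) `&` fpreimage f (W n)); split.
- move=> n m nm a [Aa [w fa [zw nzw]]]; split.
    by apply: (decA _ _ _ _ Aa); rewrite geq_max leq_max nm leq_maxr.
  by exists w => //; split=> //; apply: prefix_trans zw; apply: prefix_mkseq.
- move=> n nd; apply: (Qz n (maxn n n0)).
  have ndz : nowhere_dense (A n0 `&` fpreimage f (branch_upto z)).
    apply: thinA => v w -> ->; case: (leqP (size v) (size w)) => [|/ltnW] le.
      by left; apply: prefix_mkseq.
    by right; apply: prefix_mkseq.
  apply: nowhere_dense_sub (nowhere_denseU nd ndz) => a [Aa [w fa zw]].
  have [bw|nbw] := pselect (branch_upto z w); last by left; split=> //; exists w.
  by right; split; [apply: (decA _ _ _ _ Aa); apply: leq_maxr|exists w].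
- by move=> n a [Aa _]; apply: (decA _ _ _ _ Aa); apply: leq_maxl.
- move=> u uA C chC; apply: contrapT => /forallNP no.
  have io K : exists2 k, K <= k & fpreimage f C (u k).
    have /existsNP[k /not_implyP[Kk /contrapT fk]] := no K.
    by exists k.
  have [K0 /(_ _ _)K0P] := uA 0.
  have [k /K0P[_ [w fk [_ nzw]]] [w' fk' Cw]] := io K0.
  rewrite fk in fk'; case: fk' => ?; subst w'.
  (* Level [(size w).+1] makes the later value [w1] longer than [w]; were they comparable, [w] would
     lie on [z]. *)
  have [K1 K1P] := uA (size w).+1.
  have [k1 /K1P[_ [w1 fk1 [zw1 _]]] [w' fk1' Cw1]] := io K1.
  rewrite fk1 in fk1'; case: fk1' => ?; subst w'.
  case: (chC w w1 Cw Cw1) => [ww1|w1w].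
    apply: nzw; apply: (@mkseq_prefix _ _ (size w).+1).
    by apply: (prefix_comparable ww1 zw1); rewrite size_mkseq.
  have := leq_trans (size_prefix zw1) (size_prefix w1w).
  by rewrite size_mkseq ltnn.
Qed.

(** A fusion: [konig_thin] is applied successively for [f 0], [f 1], ..., giving sequences [S i],
    and [b] consists of distinct points [u n] of the diagonal sets [S n n]. They are eventually in
    every [S i n]. *)
Lemma convergent_set (x : nat -> bool) (X : nat -> set node)
    (f : nat -> node -> option node) :
  (forall n, dense [set a | forall i, i < n -> X i a]) ->
  exists b : set node, [/\ infinite_set b,
    forall n, finite_set (b `\` cone (mkseq x n)),
    forall i, finite_set (b `\` X i) &
    forall i m, let Y := X i `&` cone (mkseq x m) in
      (forall a, Y a -> f i a <> None) -> thin_on (f i) Y ->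
      forall C, tree_chain C -> finite_set (b `&` fpreimage (f i) C)].
Proof.
move=> dX.
pose ok (A : nat -> set node) :=
  (forall n m, n <= m -> A m `<=` A n) /\ (forall n, ~ nowhere_dense (A n)).
pose hyp i (A : nat -> set node) :=
  exists n0, (forall a, A n0 a -> f i a <> None) /\ thin_on (f i) (A n0).
pose fin i (A : nat -> set node) :=
  forall u : nat -> node, (forall n, exists K, forall k, K <= k -> A n (u k)) ->
    forall C, tree_chain C -> exists K, forall k, K <= k -> ~ fpreimage (f i) C (u k).
have [|h hP] := @choice (nat * (nat -> set node)) (nat -> set node) (fun iA A' =>
    ok iA.2 -> [/\ ok A', forall n, A' n `<=` iA.2 n & hyp iA.1 iA.2 -> fin iA.1 A']).
  case=> i A; have [[okA hypA]|no] := pselect (ok A /\ hyp i A).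
    have [A' [dA' pA' sA' fA']] := konig_thin okA.1 okA.2 hypA.
    by exists A'.
  exists A => /= okA; split; [exact: okA|by move=> n a|by move=> hypA; case: no; split].
pose A0 n := cone (mkseq x n) `&` [set a | forall i, i < n -> X i a].
pose S := fix S i := if i is j.+1 then h (j, S j) else A0.
have okS i : ok (S i).
  elim: i => [|i /(hP (i, S i))[]//]; split.
    move=> n m nm a [xa Xa]; split; first exact: prefix_trans (prefix_mkseq x nm) xa.
    by move=> i im; apply: Xa; apply: leq_trans nm.
  move=> n /(_ (mkseq x n)); apply; rewrite [S 0 n]setIC; apply: dense_in_cone.
  exact: denseW.
have SS i := hP (i, S i) (okS i).
have decS i j n m : i <= j -> n <= m -> S j m `<=` S i n.
  move=> ij nm; apply: subset_trans ((okS j).1 n m nm) _.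
  elim: j ij => [|j IH]; first by rewrite leqn0 => /eqP ->.
  rewrite leq_eqVlt => /orP[/eqP -> //|/IH le].
  by apply: subset_trans le; have [_ sub _] := SS j; apply: sub.
have [n l|u uP] := @history_choice node (fun n l a => S n n a /\ a \notin l).
  apply: contrapT => /forallNP no; apply: ((okS n).2 n).
  apply: nowhere_dense_sub (finite_nowhere_dense (finite_seq l)) => a Sa /=.
  by apply: contrapT => /negP al; apply: (no a).
have uS i n k : maxn i n <= k -> S i n (u k).
  by rewrite geq_max => /andP[ik nk]; apply: decS ik nk _ (uP k).1.
have uinj : injective u.
  have lt n m : n < m -> u n <> u m.
    by move=> nm e; have [_ /negP] := uP m; apply; rewrite -e;
      apply/mapP; exists n; rewrite ?mem_iota.
  move=> n m e; case: (ltngtP n m) => [nm|mn|-> //].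
    by case: (lt _ _ nm).
  by case: (lt _ _ mn).
have fin_range (P : set node) K : (forall k, K <= k -> ~ P (u k)) -> finite_set (range u `&` P).
  move=> noP; apply: sub_finite_set (finite_image u (finite_II K)).
  move=> _ [[k _ <-] Pk]; exists k => //=.
  by rewrite ltnNge; apply/negP => /noP.
exists (range u); split.
- apply/infiniteP; apply: (@card_le_inj _ _ _ _ u) => [k _|k l _ _ /uinj //].
  by exists k.
- move=> n; apply: (fin_range _ n) => k nk; apply.
  by have [] : S 0 n (u k) by apply: uS; rewrite max0n.
- move=> i; apply: (fin_range _ i.+1) => k ik; apply.
  have [_] : S 0 i.+1 (u k) by apply: uS; rewrite max0n.
  exact.
- move=> i m Y Ysome Ythin C chC.
  have [_ _ finS] := SS i.
  have hypS : hyp i (S i).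
    (* The index exceeds [i], which puts the points in [X i], and is at least [m], which puts them
       above [mkseq x m]. *)
    have sub : S i (maxn i.+1 m) `<=` Y.
      move=> a /(@decS 0 i (maxn i.+1 m) _ (leq0n i) (leqnn _))[xa Xa]; split.
        by apply: Xa; apply: leq_maxl.
      by apply: prefix_trans xa; apply: prefix_mkseq; apply: leq_maxr.
    exists (maxn i.+1 m); split; first by move=> a /sub/Ysome.
    by move=> D /Ythin; apply: nowhere_dense_sub => a [/sub].
  have uK n : exists K, forall k, K <= k -> S i.+1 n (u k).
    by exists (maxn i.+1 n) => k; apply: uS.
  have [K noC] := finS hypS u uK C chC.
  exact: fin_range noC.
Qed.

(** * The family of tops *)

(* The request (f, s) asks for a node t above s below which f is tame; all requests
   with the same f make such nodes t dense. *)
Notation request := ((node -> option node) * node)%type.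

Lemma countable_enum (T : Type) (S : set T) : countable S ->
  exists e : nat -> option T, (forall n j, e n = Some j -> S j) /\
    (forall j, S j -> exists n, e n = Some j).
Proof.
move=> /countable_injP[c cinj].
have [|e eP] := @choice nat (option T) (fun n o =>
    (forall j, o = Some j -> S j /\ c j = n) /\ (forall j, S j -> c j = n -> o <> None)).
  move=> n; have [[j [Sj cj]]|no] := pselect (exists j, S j /\ c j = n).
    by exists (Some j); split=> // _ [<-].
  by exists None; split=> // j Sj cj _; apply: no; exists j.
exists e; split=> [n j ej|j Sj]; first by have [/(_ _ ej)[]] := eP n.
exists (c j); case ej: (e (c j)) => [i|].
  have [/(_ _ ej)[Si cij] _] := eP (c j); congr Some.
  by apply: cinj; rewrite ?inE.
by have [_ /(_ _ Sj erefl)] := eP (c j).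
Qed.

Lemma enum_dense (T : Type) (S : set T) (A : T -> set node) (e : nat -> option T) :
  (forall n j, e n = Some j -> S j) -> (forall j, S j -> dense (A j)) ->
  (forall i j, S i -> S j -> finite_set (A i `\` A j) \/ finite_set (A j `\` A i)) ->
  forall n, dense [set a | forall i, i < n -> (if e i is Some j then A j else setT) a].
Proof.
move=> eS dA ch; apply: (@dense_chain (fun i => if e i is Some j then A j else setT)).
  move=> i; case ei: (e i) => [j|]; first exact/dA/eS/ei.
  by move=> t _; exists t => //; apply: prefix_refl.
move=> i j; case ei: (e i) => [k|]; last by right; apply: finite_setDT.
case ej: (e j) => [l|]; last by left; apply: finite_setDT.
by apply: ch; [apply: eS ei|apply: eS ej].
Qed.

Section Family.
Variable lt : request -> request -> Prop.
Hypothesis lt_omega1 : omega1_order lt.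

(** Genericity in the third clause concerns those [r] that come after all requests with map [f]. As
    nodes and initial segments are countable, this leaves out only countably many [r]. *)
Definition family_spec (A : request -> set node) (t : request -> node)
    (x : request -> nat -> bool) (b : request -> set node) : Prop :=
  [/\ forall r, tame r.1 (A r `&` cone (t r)),
      injective x,
      forall f r, (forall s, lt (f, s) r) -> exists s, branch_upto (x r) (t (f, s)),
      forall r, infinite_set (b r) /\
        forall n, finite_set (b r `\` cone (mkseq (x r) n)) &
      forall r q, lt q r -> let Y := A q `&` cone (t q) in
        branch_upto (x r) (t q) -> finite_set (b r `\` Y) /\
        ((forall a, Y a -> q.1 a <> None) -> thin_on q.1 Y ->
         forall C, tree_chain C -> finite_set (b r `&` fpreimage q.1 C))].

(** The earlier sets are a countable chain modulo finite sets; a dense pseudo-intersection of them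
    is shrunk for the map [r.1] above the node [r.2]. *)
Lemma tower : exists (A : request -> set node) (t : request -> node), forall r,
  [/\ dense (A r), prefix r.2 (t r), tame r.1 (A r `&` cone (t r)) &
      forall q, lt q r -> finite_set (A r `\` A q)].
Proof.
have [wf tr tot cseg] := lt_omega1.
have [||r g IH|g gP] := @wf_choice request (set node * node) lt (fun r g v =>
  [/\ dense v.1, prefix r.2 v.2, tame r.1 (v.1 `&` cone v.2) &
      forall q, lt q r -> finite_set (v.1 `\` (g q).1)]) wf.
- by exists (set0, [::]).
- move=> r g g' v gg' [dv rv tv fv]; split=> // q qr.
  by rewrite -gg' //; apply: fv.
- have [e [eS Se]] := countable_enum (cseg r).
  have chain i j : lt i r -> lt j r -> finite_set ((g i).1 `\` (g j).1) \/
      finite_set ((g j).1 `\` (g i).1).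
    move=> ir jr; have [_ _ _ fi] := IH i ir; have [_ _ _ fj] := IH j jr.
    case: (tot i j) => [ij|->|ji]; [by right; apply: fj| |by left; apply: fi].
    by left; rewrite setDv.
  have [Y dY fY] := pseudo_intersection (@enum_dense _ [set q | lt q r]
    (fun q => (g q).1) e eS (fun q qr => let: And4 dg _ _ _ := IH q qr in dg) chain).
  have [Z [t [ZY dZ rt tZ]]] := shrink r.1 r.2 dY.
  exists (Z, t); split=> //= q /Se[n en].
  by apply: sub_finite_set (fY n); rewrite en => a [/ZY].
- by exists (fun r => (g r).1), (fun r => (g r).2).
Qed.

(** The point [x r] is generic for countably many dense sets, one for each earlier [q]: their nodes
    leave the branch of [x q] and, when all requests with map [q.1] precede [r], extend some
    [t (q.1, s)]. *)
Lemma generic_branches (t : request -> node) : (forall r, prefix r.2 (t r)) ->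
  exists x : request -> nat -> bool,
    (forall q r, lt q r -> x q <> x r) /\
    (forall f r, (forall s, lt (f, s) r) -> exists s, branch_upto (x r) (t (f, s))).
Proof.
have [wf _ _ cseg] := lt_omega1 => tP.
have [||r g _|x xP] := @wf_choice request (nat -> bool) lt (fun r g x =>
  (forall q, lt q r -> g q <> x) /\
  (forall f, (forall s, lt (f, s) r) -> exists s, branch_upto x (t (f, s)))) wf.
- by exists xpredT.
- move=> r g g' v gg' [gv fv]; split=> // q qr.
  by rewrite -gg' //; apply: gv.
- have [e [eS Se]] := countable_enum (cseg r).
  have [x xP] := generic_branch (fun n u => if e n is Some q then
    ~ branch_upto (g q) u /\
    ((forall s, lt (q.1, s) r) -> exists s, prefix (t (q.1, s)) u) else True).
  have {}xP q : lt q r -> exists u, [/\ branch_upto x u, ~ branch_upto (g q) u &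
      (forall s, lt (q.1, s) r) -> exists s, prefix (t (q.1, s)) u].
    move=> /Se[n en]; have := xP n; rewrite en => -[|u [nu qu] xu]; last by exists u.
    (* Flipping the next bit of [g q] forces every extension of [s'] off that branch. *)
    move=> s; pose s' := rcons s (~~ g q (size s)).
    exists (t (q.1, s')).
      by apply: prefix_trans (tP (q.1, s')); apply: prefix_rcons.
    split; last by exists s'; apply: prefix_refl.
    move=> bt; have : branch_upto (g q) s'.
      by apply: (@mkseq_prefix _ _ (size (t (q.1, s')))); rewrite -bt; apply: (tP (q.1, s')).
    rewrite /branch_upto /s' size_rcons mkseqS => /rcons_inj[_].
    by case: (g q _).
  exists x; split=> [q /xP[u [xu nu _]] gx|f fr]; first by rewrite gx in nu.
  have [u [xu _ /(_ fr)[s su]]] := xP _ (fr [::]).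
  exists s; apply: (@mkseq_prefix _ _ (size u)).
  by rewrite -xu.
- by exists x; split=> [q r|f r]; have [] := xP r; [move=> h _; apply: h|move=> _; apply].
Qed.

Lemma family_exists : exists (A : request -> set node) (t : request -> node)
    (x : request -> nat -> bool) (b : request -> set node), family_spec A t x b.
Proof.
have [wf tr tot cseg] := lt_omega1.
have [A [t At]] := tower.
have [x [xlt xt]] : exists x : request -> nat -> bool,
    (forall q r, lt q r -> x q <> x r) /\
    (forall f r, (forall s, lt (f, s) r) -> exists s, branch_upto (x r) (t (f, s))).
  by apply: generic_branches => r; have [] := At r.
have [|b bP] := @choice request (set node) (fun r b =>
   [/\ infinite_set b, forall n, finite_set (b `\` cone (mkseq (x r) n)) &
     forall q, lt q r -> finite_set (b `\` A q) /\
       forall m, let Y := A q `&` cone (mkseq (x r) m) in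
        (forall a, Y a -> q.1 a <> None) -> thin_on q.1 Y ->
         forall C, tree_chain C -> finite_set (b `&` fpreimage q.1 C)]).
  move=> r; have [e [eS Se]] := countable_enum (cseg r).
  have chain i j : lt i r -> lt j r ->
      finite_set (A i `\` A j) \/ finite_set (A j `\` A i).
    move=> ir jr; have [_ _ _ fi] := At i; have [_ _ _ fj] := At j.
    case: (tot i j) => [ij|->|ji]; [by right; apply: fj| |by left; apply: fi].
    by left; rewrite setDv.
  have dX := @enum_dense _ [set q | lt q r] A e eS
    (fun q _ => let: And4 dA _ _ _ := At q in dA) chain.
  have [b [infb xb Ab fb]] := convergent_set (x r)
      (fun n => if e n is Some q then q.1 else fun=> None) dX.
  exists b; split=> // q /Se[n en].
  by split=> [|m]; [have := Ab n|have := fb n m]; rewrite en.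
exists A, t, x, b; split=> //.
- by move=> r; have [] := At r.
- move=> q r; case: (tot q r) => [/xlt //|//|/xlt h /esym //].
- by move=> r; have [] := bP r.
- move=> r q qr Y xq; have [_ bx bA] := bP r; have [fA fC] := bA q qr.
  split.
    by apply: finite_setDI fA _; rewrite /branch_upto in xq; rewrite xq.
  (* As [x r] passes through [t q], its initial segment of this length is [t q]. *)
  by have := fC (size (t q)); rewrite -xq.
Qed.
End Family.

(** * Minors *)

(** CH enters here: a request is coded by a set of naturals, so aleph_1 stages suffice to treat
    every map. *)
Lemma aleph1_requests : continuum_hypothesis -> aleph1_card [set: request].
Proof.
move=> [unc le]; split.
  move=> c; apply: unc.
  apply: (@countable_inj _ _ _ _ (fun X : set nat =>
    ((fun a => if `[< X (size a) >] then Some [::] else None), [::]) : request) c) => //.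
  move=> X Y _ _ [e]; apply/seteqP; split=> n Xn; apply: contrapT => nYn;
    have := congr1 (@^~ (nseq n true)) e; rewrite size_nseq;
    case: asboolP => //; case: asboolP => //.
move=> U Y /le; apply: card_le_trans.
pose code (r : request) : set nat :=
  [set n | exists a, n = pickle (inl (a, r.1 a) : (node * option node) + node)]
  `|` [set pickle (inr r.2 : (node * option node) + node)].
apply: (@card_le_inj _ _ _ _ code) => // -[f s] [g t] _ _ e.
have inj_pickle := pcan_inj (@pickleK ((node * option node) + node)%type).
congr pair.
  apply: functional_extensionality_dep => a.
  have : code (g, t) (pickle (inl (a, f a) : (node * option node) + node)).
    by rewrite -e; left; exists a.
  by case=> [[a' /inj_pickle[-> ->]]|/inj_pickle].
have : code (g, t) (pickle (inr s : (node * option node) + node)).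
  by rewrite -e; right.
by case=> [[a' /inj_pickle]|/inj_pickle[]].
Qed.

(** * The graph of nodes and tops, and the traces of its minors *)

Section Tops.
Variables (I : Type) (b : I -> set node).

Definition tops_adj (u v : node + I) : Prop :=
  match u, v with
  | inl a, inr i | inr i, inl a => b i a
  | _, _ => False
  end.

Lemma tops_sym u v : tops_adj u v -> tops_adj v u.
Proof. by case: u; case: v => /=. Qed.

Lemma tops_irrefl u : ~ tops_adj u u.
Proof. by case: u => ? []. Qed.

Lemma tops_verts u v : tops_adj u v -> [set: node + I] u.
Proof. by []. Qed.

Definition tops_graph : graph (node + I) := Graph tops_sym tops_irrefl tops_verts.

(** Tops are pairwise nonadjacent. *)
Lemma tops_connected (S : set (node + I)) i v : (forall a, ~ S (inl a)) ->
  connected_set tops_graph S -> S (inr i) -> S v -> v = inr i.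
Proof.
move=> noS [_ _ con] Si Sv.
have := con _ _ Si Sv.
suff: forall u, clos_refl_trans _ (induced_adj tops_graph S) u v -> u = inr i -> v = inr i.
  by move=> h /h; apply.
move=> u; elim=> // {u v Sv} [[a|j] [a'|j'] [Su Sv] //|u v w _ IH1 _ IH2 /IH1/IH2 //].
all: by [case: (noS _ Su)|case: (noS _ Sv)].
Qed.

(** [N] collects the vertices whose branch sets contain a node, countably many by disjointness. Any
    other vertex of [D] has a single top [sigma d] as branch set, and [g] names the branch set
    containing a node. *)
Lemma minor_trace (W : Type) (H : graph W) (C D : set W) (i0 : I) :
  minor H tops_graph -> bipartition H C D ->
  exists (N : set W) (sigma : W -> I) (g : node -> option W),
  [/\ countable N,
      forall d d', D d -> D d' -> ~ N d -> ~ N d' -> sigma d = sigma d' -> d = d' &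
      forall d c, D d -> ~ N d -> adj H d c -> exists2 a, b (sigma d) a & g a = Some c].
Proof.
move=> [V [Vcon Vdisj Vadj]] [vH _ _].
have Vuniq w w' u : verts H w -> verts H w' -> V w u -> V w' u -> w = w'.
  by move=> Hw Hw' Vu V'u; apply: (Vdisj w w' Hw Hw'); exists u.
pose N := [set w | verts H w /\ exists a, V w (inl a)].
have [|g gP] := @choice node (option W)
    (fun a o => forall w, verts H w -> V w (inl a) -> o = Some w).
  move=> a; have [[w [Hw Vw]]|no] := pselect (exists w, verts H w /\ V w (inl a)).
    by exists (Some w) => w' Hw' Vw'; congr Some; apply: Vuniq Vw Vw'.
  by exists None => w Hw Vw; case: no; exists w.
have DH d : D d -> verts H d by rewrite vH; right.
have noV d : D d -> ~ N d -> forall a, ~ V d (inl a).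
  by move=> Dd nN a Va; apply: nN; split; [apply: DH|exists a].
have [|sigma sP] := @choice W I (fun w i => D w -> ~ N w -> V w (inr i)).
  move=> w; have [[Dw nNw]|no] := pselect (D w /\ ~ N w); last first.
    by exists i0 => Dw nNw; case: no.
  have [_ [[a|i] Vw] _] := Vcon w (DH w Dw); first by case: (noV w Dw nNw a).
  by exists i.
exists N, sigma, g; split.
- have [|h hP] := @choice W node (fun w a => N w -> V w (inl a)).
    move=> w; have [[Hw [a Va]]|no] := pselect (N w); first by exists a.
    by exists [::] => Nw; case: no.
  apply: (@countable_inj _ _ _ [set: node] h) => [|//|w w' Nw Nw' e].
    exact: countableP.
  by apply: (Vuniq _ _ (inl (h w))); [exact: Nw.1|exact: Nw'.1|exact: hP|rewrite e; exact: hP].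
- move=> d d' Dd Dd' nN nN' e; apply: (Vuniq _ _ (inr (sigma d))); try exact: DH.
    exact: sP.
  by rewrite e; apply: sP.
- move=> d c Dd nN dc; have [u [v [Vu Vv uv]]] := Vadj d c dc.
  have eu := tops_connected (noV d Dd nN) (Vcon d (DH d Dd)) (sP d Dd nN) Vu.
  rewrite eu in uv; case: v uv Vv => //= a ba Va; exists a => //.
  by apply: gP Va; apply: adj_verts (adj_sym dc).
Qed.

End Tops.

(** [kappa] embeds the exceptional vertices into the finite image of [X] minus [Y] under [f]. *)
Lemma traced_cofinite (W : Type) (N : set W) (kappa : W -> option node)
    (f : node -> option node) (X Y : set node) :
  (forall c c', N c -> N c' -> kappa c = kappa c' -> c = c') ->
  (forall c, N c -> exists2 a, X a & f a = kappa c) ->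
  finite_set (X `\` Y) ->
  finite_set [set c | N c /\ ~ exists a, [/\ X a, Y a & f a = kappa c]].
Proof.
move=> kinj tr /(finite_image f) fXY; apply: card_le_finite fXY.
apply: (@card_le_inj _ _ _ _ kappa) => [c [Nc no]|c c' [Nc _] [Nc' _]]; last exact: kinj.
have [a Xa fa] := tr c Nc; exists a => //; split=> // Ya.
by apply: no; exists a.
Qed.

(* For [d] in [S] the branch set is a single top of the host; [beta d] is the set
   of neighbours of that top and [y d] its limit. *)
Lemma minor_capture (lt : request -> request -> Prop) (A : request -> set node)
    (t : request -> node) (x : request -> nat -> bool) (b : request -> set node) :
  omega1_order lt -> family_spec lt A t x b ->
  forall (W : Type) (H : graph W) (C D D1 : set W) (kappa : W -> option node),
  minor H (tops_graph b) -> aleph01_graph H C D ->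
  D1 `<=` D -> ~ countable D1 ->
  (forall d c, D1 d -> adj H d c -> kappa c <> None) ->
  (forall c c', verts H c -> verts H c' -> kappa c <> None -> kappa c = kappa c' -> c = c') ->
  exists (S : set W) (f : node -> option node) (Y : set node)
    (y : W -> nat -> bool) (beta : W -> set node),
  [/\ S `<=` D1 /\ ~ countable S,
      (forall d d', S d -> S d' -> y d = y d' -> d = d') /\
        (forall d n, S d -> finite_set (beta d `\` cone (mkseq (y d) n))),
      forall a a', Y a -> Y a' -> f a = f a' -> a = a',
      (exists2 C0, tree_chain C0 & Y `<=` fpreimage f C0) \/
        (forall d, S d -> forall C0, tree_chain C0 -> finite_set (beta d `&` fpreimage f C0)) &
      forall d, S d -> finite_set (beta d `\` Y) /\
        (forall c, adj H d c -> exists2 a, beta d a & f a = kappa c)].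
Proof.
move=> [_ _ tot cseg] [tameA xinj xt bx bA] W H C D D1 kappa mH [bip _ _ Dinf] D1D uD1 kS kinj.
have [N [sigma [g [cN sinj tr]]]] := minor_trace ((fun=> None), [::]) mH bip.
(* With the small side coded by nodes through [kappa], the trace becomes one of the maps treated in
   the recursion. *)
pose f : node -> option node := fun a => obind kappa (g a).
have {tr} tr d c : D1 d -> ~ N d -> adj H d c -> exists2 a, b (sigma d) a & f a = kappa c.
  by move=> /D1D Dd nN /(tr d c Dd nN)[a ba ga]; exists a => //; rewrite /f ga.
pose bad := \bigcup_(n in [set: nat]) [set d | (D1 d /\ ~ N d) /\ ~ lt (f, nth_node n) (sigma d)].
have cbad : countable bad.
  apply: bigcup_countable => // n _.
  apply: (@countable_inj _ _ _ ([set r | lt r (f, nth_node n)] `|` [set (f, nth_node n)]) sigma).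
  - have := @bigcup_countable _ _ [set: bool]
      (fun i => if i then [set r | lt r (f, nth_node n)] else [set (f, nth_node n)]).
    have -> : \bigcup_(i in [set: bool]) (if i then [set r | lt r (f, nth_node n)]
        else [set (f, nth_node n)]) = [set r | lt r (f, nth_node n)] `|` [set (f, nth_node n)].
      apply/seteqP; split=> [r [[] _ ?]|r [?|?]]; [by left|by right|by exists true|by exists false].
    apply; first exact: countableP.
    by case=> _; [apply: cseg|apply: countable1].
  - by move=> d [_ nlt]; case: (tot (f, nth_node n) (sigma d)) => [//|->|?]; [right|left].
  - by move=> d d' [[Dd nN] _] [[Dd' nN'] _]; apply: sinj => //; apply: D1D.
have uS0 := uncountable_setD (uncountable_setD uD1 cN) cbad.
(* Each remaining limit passes through [t (f, s)] for some [s]; one [s] serves uncountably many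
   vertices. *)
have [|n uS] := @uncountable_bigcup _ _ (fun n => [set d |
    branch_upto (x (sigma d)) (t (f, nth_node n))]) uS0.
  move=> d [[Dd nN] nbad]; have [|s xs] := xt f (sigma d); last first.
    by exists (pickle s); rewrite /= nth_nodeK.
  move=> s; apply: contrapT => nlt; apply: nbad; exists (pickle s) => //.
  by rewrite /= nth_nodeK.
set S := _ `&` _ in uS; set q := (f, nth_node n) in S uS.
pose Y := A q `&` cone (t q).
have SP d : S d -> [/\ D1 d, ~ N d, lt q (sigma d) & branch_upto (x (sigma d)) (t q)].
  move=> [[[Dd nN] nbad] xd]; split=> //.
  by apply: contrapT => nlt; apply: nbad; exists n.
have trS d : S d -> finite_set (b (sigma d) `\` Y) /\
    (forall c, adj H d c -> exists2 a, b (sigma d) a & f a = kappa c).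
  move=> /SP[Dd nN ltd xd]; have [fY _] := bA _ _ ltd xd; split=> // c; exact: tr.
(* A constant [f] is impossible: all but finitely many neighbours of [d] would have the same code
   [v]. *)
have [[v vY]|[Ysome Yinj YC]] := tameA q.
  have [d Sd] := uncountable_ex uS.
  have [Dd _ _ _] := SP d Sd; have [fY trd] := trS d Sd.
  have kd c c' : neighbours H d c -> neighbours H d c' -> kappa c = kappa c' -> c = c'.
    move=> dc dc'; apply: kinj; [exact: adj_verts (adj_sym dc)|
      exact: adj_verts (adj_sym dc')|exact: kS dc].
  have := infinite_setD (Dinf d (D1D d Dd)) (traced_cofinite kd trd fY).
  set R := _ `\` _ => infR.
  have Rv c : R c -> neighbours H d c /\ kappa c = v.
    move=> [dc no]; split=> //; apply: contrapT => nv; apply: no; split=> // -[a [ba Ya fa]].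
    by apply: nv; rewrite -fa; apply: vY.
  have [c0 /Rv[dc0 kc0]] := infinite_setN0 infR.
  case: infR; apply: sub_finite_set (finite_set1 c0) => c /Rv[dc kc].
  by apply: kd => //; rewrite kc.
exists S, f, Y, (x \o sigma), (b \o sigma); split=> //.
- by split=> // d /SP[].
- split=> [d d' /SP[Dd nN _ _] /SP[Dd' nN' _ _] /xinj|d m _]; last by have [_] := bx (sigma d).
  by apply: sinj => //; apply: D1D.
- case: YC => [?|thin]; [by left|right=> d /SP[_ _ ltd xd] C0 chC0].
  by have [_ +] := bA _ _ ltd xd; apply.
Qed.

(** Discard the countably many cones containing countably many points. Two remaining points first
    differ at some [n], and both children of their common segment then carry uncountably many. *)
Lemma splitting_node (W : Type) (S : set W) (y : W -> nat -> bool) :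
  ~ countable S -> (forall d d', S d -> S d' -> y d = y d' -> d = d') ->
  exists u, forall i, ~ countable (S `&` [set d | branch_upto (y d) (rcons u i)]).
Proof.
move=> uS yinj; pose P u := S `&` [set d | branch_upto (y d) u].
pose Z := \bigcup_(u in [set u | countable (P u)]) P u.
have cZ : countable Z by apply: bigcup_countable => //; apply: countableP.
have uSZ := uncountable_setD uS cZ.
have [d [d' [[Sd nZ] [Sd' nZ'] dd']]] : exists d d', [/\ (S `\` Z) d, (S `\` Z) d' & d <> d'].
  have [d SZd] := uncountable_ex uSZ.
  apply: contrapT => no; apply: uSZ.
  apply: sub_countable (countable1 d); apply: subset_card_le => d' SZd'.
  by apply: contrapT => e; apply: no; exists d', d.
have [n neq mn] : exists2 n, y d n != y d' n & forall m, m < n -> y d m = y d' m.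
  have ex : exists n, y d n != y d' n.
    apply: contrapT => /forallNP no; apply: dd'; apply: yinj => //.
    by apply: functional_extensionality_dep => n; apply/eqP/negPn/negP/no.
  exists (ex_minn ex); case: ex_minnP => // n _ nmin m mn.
  by apply/eqP/negPn/negP => /nmin; rewrite leqNgt mn.
have big e m : S e -> ~ Z e -> ~ countable (P (mkseq (y e) m)).
  move=> Se nZe c; apply: nZe; exists (mkseq (y e) m) => //; split=> //.
  by rewrite /= /branch_upto size_mkseq.
have e : mkseq (y d') n = mkseq (y d) n.
  by apply/eq_in_map => m; rewrite mem_iota => /mn ->.
exists (mkseq (y d) n) => i; have [->|/negPf ni] := eqVneq i (y d n).
  by rewrite -mkseqS; apply: big.
have -> : i = y d' n by move: neq ni; case: i (y d n) (y d' n) => [] [] [].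
by rewrite -e -mkseqS; apply: big.
Qed.

Lemma contains_aleph01_sub (W : Type) (H : graph W) (C D C1 S : set W) :
  aleph01_graph H C D -> C1 `<=` C -> S `<=` D -> ~ countable S ->
  (forall d, S d -> infinite_set (neighbours H d `&` C1)) ->
  contains_aleph01_graph (induced H (C1 `|` D)).
Proof.
move=> [[vH CD bip] C0 [_ D1] Dinf] C1C SD uS infS.
exists (induced H (C1 `|` S)), C1, S; split.
  split=> [w [Hw [?|/SD ?]]|w w' [Sw Sw' ww']]; first by split=> //; left.
    by split=> //; right.
  have sub v : (C1 `|` S) v -> (C1 `|` D) v by case=> [?|/SD ?]; [left|right].
  by split=> //; apply: sub.
split.
- split.
  + apply/seteqP; split=> [w [] //|w Sw]; split=> //; rewrite vH.
    by case: Sw => [/C1C|/SD]; [left|right].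
  + apply/seteqP; split=> // w [/C1C Cw /SD Dw]; rewrite -CD; by split.
  + have disj w : C w -> D w -> False by move=> Cw Dw; have : (C `&` D) w by []; rewrite CD.
    move=> w w' [Sw Sw' /bip[[Cw Dw']|[Dw Cw']]]; [left|right]; split.
    * by case: Sw => // /SD /(disj w Cw).
    * by case: Sw' => // /C1C /disj /(_ Dw').
    * by case: Sw => // /C1C /disj /(_ Dw).
    * by case: Sw' => // /SD /(disj w' Cw').
- have [d Sd] := uncountable_ex uS.
  rewrite /aleph0_card card_eq_le; apply/andP; split.
    by apply: card_le_trans (subset_card_le C1C) _;
      move: C0; rewrite /aleph0_card card_eq_le => /andP[].
  by apply/infiniteP; apply: sub_infinite_set (infS d Sd) => w [].
- by split=> // U Y /D1; apply: card_le_trans; apply: subset_card_le.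
- move=> d Sd; apply: sub_infinite_set (infS d Sd) => c [dc C1c].
  by split=> //; [right|left].
Qed.

(** A node has finitely many prefixes, so both branches lie in the downward closure of [C0]. Hence
    their union is a chain, and maximality makes them equal. *)
Lemma tree_branch_eq (C0 y y' : set node) : tree_chain C0 -> tree_branch y -> tree_branch y' ->
  infinite_set (y `&` C0) -> infinite_set (y' `&` C0) -> y = y'.
Proof.
move=> chC0 [chy maxy] [chy' maxy'] inf inf'.
have above z : tree_chain z -> infinite_set (z `&` C0) ->
    forall u, z u -> exists2 v, C0 v & prefix u v.
  move=> chz infz u zu; apply: contrapT => no; apply: infz.
  have sub : z `&` C0 `<=` [set v | prefix v u].
    move=> v [zv Cv]; case: (chz u v zu zv) => // uv.
    by case: no; exists v.
  apply: sub_finite_set sub _.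
  apply: sub_finite_set (finite_image (take^~ u) (finite_II (size u).+1)) => v.
  rewrite /= prefixE => /eqP e; exists (size v) => //=.
  by rewrite ltnS; apply: size_prefix; rewrite prefixE e.
have comp u u' v v' : C0 v -> C0 v' -> prefix u v -> prefix u' v' -> prefix u u' \/ prefix u' u.
  move=> Cv Cv' uv uv'.
  have [w [uw u'w]] : exists w, prefix u w /\ prefix u' w.
    case: (chC0 v v' Cv Cv') => [vv'|v'v]; [exists v'|exists v]; split=> //.
      exact: prefix_trans vv'.
    exact: prefix_trans v'v.
  case: (leqP (size u) (size u')) => [|/ltnW] le; [left|right].
    exact: prefix_comparable uw u'w le.
  exact: prefix_comparable u'w uw le.
have ch : tree_chain (y `|` y').
  have ab u : (y `|` y') u -> exists2 v, C0 v & prefix u v.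
    by case=> [/(above y chy inf)|/(above y' chy' inf')].
  by move=> u u' /ab[v Cv uv] /ab[v' Cv' uv']; apply: comp Cv Cv' uv uv'.
have ey : y `|` y' = y by apply: maxy => // u; left.
by rewrite -ey; apply: maxy' => // u; right.
Qed.

(** * The host graph *)

Lemma tops_aleph01 (I : Type) (b : I -> set node) : aleph1_card [set: I] ->
  (forall i, infinite_set (b i)) ->
  aleph01_graph (tops_graph b) (inl @` [set: node]) (inr @` [set: I]).
Proof.
move=> [uI leI] infb; split.
- split.
  + by apply/seteqP; split=> // -[a|i] _; [left; exists a|right; exists i].
  + by apply/seteqP; split=> // _ [[a _ <-] [i _]].
  + by move=> [a|i] [a'|i'] //= _; [left|right]; split; do ?[exists a|exists a'|exists i|exists i'].
- rewrite /aleph0_card card_eq_le; apply/andP; split.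
    apply: (@countable_inj _ _ _ [set: node]
      (fun u : node + I => if u is inl a then a else [::])) => //.
    by move=> _ _ [a _ <-] [a' _ <-] /= ->.
  apply: (@card_le_inj _ _ _ _ (fun n => inl (nseq n true))) => [n _|n m _ _ [/(congr1 size)]].
    by exists (nseq n true).
  by rewrite !size_nseq.
- split=> [cI|U Y /leI]; last by apply: card_le_trans; apply: card_image_le.
  apply: uI; apply: (@countable_inj _ _ _ _ inr cI) => [i _|i i' _ _ [//]].
  by exists i.
- move=> _ [i _ <-] fin; apply: (infb i).
  apply: sub_finite_set (finite_image (fun u : node + I => if u is inl a then a else [::]) fin).
  by move=> a ba; exists (inl a).
Qed.

(** Once the limits differ, the two sets almost lie in disjoint cones. *)
Lemma almost_disjoint_tops (I : Type) (x : I -> nat -> bool) (b : I -> set node) :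
  injective x -> (forall i n, finite_set (b i `\` cone (mkseq (x i) n))) ->
  almost_disjoint (tops_graph b) (inr @` [set: I]).
Proof.
move=> xinj bx _ _ [i _ <-] [j _ <-] ij.
have [n xn] : exists n, x i n <> x j n.
  apply/existsNP => e; apply: ij; congr inr; apply: xinj.
  exact: functional_extensionality_dep.
apply: sub_finite_set (finite_image inl (_ : finite_set (b i `&` b j))).
  by move=> [a|k] [] //= bi bj; exists a.
apply: finite_cover (bx i n.+1) (bx j n.+1) _ => a [bi bj].
apply: contrapT => /not_orP[/not_andP[//|/contrapT ai] /not_andP[//|/contrapT aj]].
have := prefix_comparable ai aj; rewrite !size_mkseq => /(_ (leqnn _)).
by rewrite prefixE size_mkseq take_oversize ?size_mkseq // !mkseqS => /eqP/rcons_inj[_ /esym].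
Qed.

(** * Excluding indivisible minors and minors of binary type *)

Section Minors.
Variables (lt : request -> request -> Prop) (A : request -> set node)
  (t : request -> node) (x : request -> nat -> bool) (b : request -> set node).
Hypothesis lt_omega1 : omega1_order lt.
Hypothesis fam : family_spec lt A t x b.

Lemma minor_divisible (W : Type) (H : graph W) (C D : set W) :
  minor H (tops_graph b) -> aleph01_graph H C D -> ~ indivisible H C D.
Proof.
move=> mH aH; have [[vH CD bip] C0 [uD _] Dinf] := aH.
have DnC d : D d -> ~ C d by move=> Dd Cd; have : (C `&` D) d by []; rewrite CD.
have [c cinj] : exists c : W -> nat, {in C &, injective c}.
  by apply/countable_injP; move: C0; rewrite /aleph0_card card_eq_le => /andP[].
pose kappa w := if pselect (C w) then Some (nseq (c w) true) else None.
have kC w : C w -> kappa w = Some (nseq (c w) true) by rewrite /kappa; case: pselect.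
have kN w : kappa w <> None -> C w by rewrite /kappa; case: pselect.
have adjC d w : D d -> adj H d w -> C w.
  by move=> Dd /bip[[Cd _]|[]//]; case: (DnC d).
have kD d w : D d -> adj H d w -> kappa w <> None by move=> Dd /(adjC d w Dd) Cw; rewrite kC.
have kinj w w' : verts H w -> verts H w' -> kappa w <> None -> kappa w = kappa w' -> w = w'.
  move=> _ _ kw e; have Cw := kN _ kw; have Cw' : C w' by apply: kN; rewrite -e.
  move: e; rewrite !kC // => -[/(congr1 size)]; rewrite !size_nseq.
  by apply: cinj; rewrite inE.
have [S [f [Y [y [beta [[SD uS] [yinj by_] Yinj _ bS]]]]]] :=
  minor_capture lt_omega1 fam mH aH (@subset_refl _ D) uD kD kinj.
have [u uu] := splitting_node uS yinj.
(* The small side is split by the child of [u] below the tracing node, unique as [f] is injective on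
   [Y]. A top whose limit passes through that child keeps almost all its neighbours. *)
pose Ci i := [set w | C w /\ exists a, [/\ Y a, prefix (rcons u i) a & f a = kappa w]].
have Ci_inf i d : S d -> branch_upto (y d) (rcons u i) -> infinite_set (neighbours H d `&` Ci i).
  move=> Sd du; have [bY trd] := bS d Sd; have Dd := SD d Sd.
  have bYu : finite_set (beta d `\` (Y `&` cone (rcons u i))).
    by apply: finite_setDI bY _; rewrite /branch_upto in du; rewrite du; apply: by_.
  have kd w w' : neighbours H d w -> neighbours H d w' -> kappa w = kappa w' -> w = w'.
    move=> dw dw'; apply: kinj; [exact: adj_verts (adj_sym dw)|
      exact: adj_verts (adj_sym dw')|exact: kD dw].
  apply: sub_infinite_set (infinite_setD (Dinf d Dd) (traced_cofinite kd trd bYu)).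
  move=> w [dw nw]; split=> //; split; first exact: adjC dw.
  have : exists a, [/\ beta d a, (Y `&` cone (rcons u i)) a & f a = kappa w].
    by apply: contrapT => no; apply: nw.
  by case=> a [_ [Ya ua] fa]; exists a.
have Ci_disj w : Ci true w -> ~ Ci false w.
  move=> [_ [a [Ya ua fa]]] [_ [a' [Ya' ua' fa']]].
  have e : a = a' by apply: Yinj => //; rewrite fa.
  have := prefix_comparable ua; rewrite e => /(_ _ ua'); rewrite !size_rcons => /(_ (leqnn _)).
  by rewrite prefixE size_rcons take_oversize ?size_rcons // => /eqP/rcons_inj[].
move=> /(_ (Ci true) (C `\` Ci true)); apply.
- by apply/seteqP; split=> [w Cw|w [[]|[]]//]; have [?|?] := pselect (Ci true w); [left|right].
- by apply/seteqP; split=> // w [? []].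
have contains i (C' : set W) : C' `<=` C -> Ci i `<=` C' ->
    contains_aleph01_graph (induced H (C' `|` D)).
  move=> C'C CiC'; apply: (contains_aleph01_sub aH C'C _ (uu i)) => [d [/SD]//|d [Sd du]].
  by apply: sub_infinite_set (Ci_inf i d Sd du) => w [dw /CiC'].
split; first by apply: (contains true) => // w [].
apply: (contains false) => [w []//|w Cw]; split; first exact: Cw.1.
by move=> /Ci_disj.
Qed.

Lemma minor_not_binary (W : Type) (H : graph W) (C D : set W) :
  minor H (tops_graph b) -> aleph01_graph H C D -> ~ binary_type H.
Proof.
move=> mH aH [T [[B [Bbr _ vT noTT nbT]] [phi [phibij phiadj]]]].
have [[vH CD bip] C0 [uD _] Dinf] := aH.
have [phiV phiinj _] := phibij.
have DH d : D d -> verts H d by rewrite vH; right.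
have pinj w w' : verts H w -> verts H w' -> phi w = phi w' -> w = w'.
  by move=> Hw Hw'; apply: phiinj; rewrite inE.
(* The isomorphism may exchange vertices of the two sides, but sends only countably many vertices of
   [D] to nodes. *)
pose D1 := [set d | D d /\ exists2 y, B y & phi d = inr y].
have uD1 : ~ countable D1.
  have cD2 : countable [set d | D d /\ exists s, phi d = inl s].
    apply: (@countable_inj _ _ _ [set: node]
      (fun d => if phi d is inl s then s else [::])) => [|//|d d' [Dd [s e]] [Dd' [s' e']]].
      exact: countableP.
    by rewrite e e' => ss; apply: pinj; try exact: DH; rewrite e e' ss.
  move=> cD1; apply: (uncountable_setD uD cD2); apply: sub_countable cD1.
  apply: subset_card_le => d [Dd nd]; split=> //.
  have := phiV d (DH d Dd); rewrite vT => -[[s _ e]|[y By e]].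
  - by case: nd; split=> //; exists s.
  - by exists y.
pose kappa w := if phi w is inl s then Some s else None.
have nb d y w : phi d = inr y -> B y -> adj H d w -> exists2 s, phi w = inl s & y s.
  move=> e By dw; have [sub _] := nbT y By.
  have : neighbours T (inr y) (phi w).
    by rewrite /neighbours /= -e -phiadj //; [exact: adj_verts dw|exact: adj_verts (adj_sym dw)].
  by move=> /sub[s ys es]; exists s.
have kD d w : D1 d -> adj H d w -> kappa w <> None.
  by move=> [_ [y By e]] /(nb d y w e By)[s es _]; rewrite /kappa es.
have kinj w w' : verts H w -> verts H w' -> kappa w <> None -> kappa w = kappa w' -> w = w'.
  rewrite /kappa => Hw Hw'; case e: (phi w) => [s|//]; case e': (phi w') => [s'|//] _ [ss].
  by apply: pinj => //; rewrite e e' ss.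
have [S [f [Y [y [beta [[SD uS] _ _ YC bS]]]]]] :=
  minor_capture lt_omega1 fam mH aH (fun d (Dd : D1 d) => Dd.1) uD1 kD kinj.
have inf_trace d z (Z : set node) : S d -> B z -> phi d = inr z -> finite_set (beta d `\` Z) ->
    infinite_set [set s | z s /\ exists a, [/\ beta d a, Z a & f a = Some s]].
  move=> Sd Bz ez bZ fin; have [bY trd] := bS d Sd; have D1d := SD d Sd.
  have kd w w' : neighbours H d w -> neighbours H d w' -> kappa w = kappa w' -> w = w'.
    move=> dw dw'; apply: kinj; [exact: adj_verts (adj_sym dw)|
      exact: adj_verts (adj_sym dw')|exact: kD dw].
  apply: (infinite_setD (Dinf d D1d.1) (traced_cofinite kd trd bZ)).
  apply: card_le_finite (finite_image Some fin).
  apply: (@card_le_inj _ _ _ _ kappa) => [w [dw nw]|w w' [dw _] [dw' _]]; last exact: kd.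
  have [s es zs] := nb d z w ez Bz dw; exists s; last by rewrite /kappa es.
  split=> //; apply: contrapT => no; apply: nw; split=> // -[a [ba Za fa]].
  by apply: no; exists a; split=> //; rewrite fa /kappa es.
case: YC => [[C1 chC1 YC]|thin].
(* All branches met by [S] share infinitely many nodes with [C1], so they coincide and [S] is a
   single point. *)
- have [d Sd] := uncountable_ex uS.
  apply: uS; apply: sub_countable (countable1 d); apply: subset_card_le => d' Sd'.
  have [Dd [z Bz ez]] := SD d Sd; have [Dd' [z' Bz' ez']] := SD d' Sd'.
  apply: pinj; [exact: DH|exact: DH|rewrite ez ez'; congr inr].
  have inC e v : S e -> B v -> phi e = inr v -> infinite_set (v `&` C1).
    move=> Se Bv ev; have [bY _] := bS e Se.
    apply: sub_infinite_set (inf_trace e v Y Se Bv ev bY) => s [vs [a [_ /YC[s' fs' Cs'] fa]]].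
    by split=> //; move: fs'; rewrite fa => -[->].
  by apply: (tree_branch_eq chC1 (Bbr _ Bz') (Bbr _ Bz)); [apply: inC ez'|apply: inC ez].
(* Thinness is applied to the branch [z] of the top itself, which contains all its neighbours. *)
- have [d Sd] := uncountable_ex uS.
  have [_ [z Bz ez]] := SD d Sd; have [chz _] := Bbr _ Bz.
  apply: (inf_trace d z setT Sd Bz ez (finite_setDT _)).
  have := finite_image f (thin d Sd z chz).
  move=> /(finite_image (fun o => if o is Some s then s else [::])); apply: sub_finite_set.
  move=> s [zs [a [ba _ fa]]]; exists (Some s) => //; exists a => //; split=> //.
  by exists s.
Qed.

End Minors.

Theorem theorem5p1 :
  continuum_hypothesis ->
  exists (V : Type) (G : graph V) (A B : set V),
    [/\ aleph01_graph G A B,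
        almost_disjoint G B &
        forall (W : Type) (H : graph W) (C D : set W),
          minor H G -> aleph01_graph H C D ->
          ~ indivisible H C D /\ ~ binary_type H].
Proof.
move=> CH; have aR := aleph1_requests CH.
have [lt lt_omega1] := aleph1_order aR.
have [A [t [x [b fam]]]] := family_exists lt_omega1.
have [_ xinj _ bx _] := fam.
exists (node + request)%type, (tops_graph b), (inl @` setT), (inr @` setT); split.
- by apply: tops_aleph01 => // r; have [] := bx r.
- by apply: (almost_disjoint_tops xinj) => r; have [] := bx r.
- move=> W H C D mH aH; split; first exact: (minor_divisible lt_omega1 fam mH aH).
  exact: (minor_not_binary lt_omega1 fam mH aH).
Qed.
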